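(* Let $T=(T_1,\ldots,T_n)\in B(H)^n$ be a commuting tuple of degree $\gamma$. Then the mapping $$W\mapsto[W]=\bigvee_{k\in\mathbb N^n}T^kW$$ defines a bijection between the homogeneous wandering subspaces for $T$ and the homogeneous closed $T$-invariant subspaces of $H$. The inverse of this mapping is given by $$M\mapsto W_T(M)=M\ominus\sum_{i=1}^nT_iM.$$
   Context: $\mathbb N=\{0,1,2,\ldots\}$. $H$ is a complex Hilbert space with a fixed orthogonal decomposition into closed subspaces $H_k$ ($k\in\mathbb N$), i.e. $H$ is the Hilbert space orthogonal direct sum of the $H_k$. Let $\gamma=(\gamma_1,\ldots,\gamma_n)$ be a tuple of integers $\gamma_i>0$. A commuting tuple $T\in B(H)^n$ of bounded operators is of degree $\gamma$ if $T_iH_k\subset H_{k+\gamma_i}$ for all $k\in\mathbb N$, $i=1,\ldots,n$. A closed subspace $M\subset H$ is homogeneous if $M$ is the closed linear span of the spaces $M\cap H_k$ ($k\in\mathbb N$). A closed subspace $M$ is $T$-invariant if $T_iM\subset M$ for all $i$. A closed subspace $W\subset H$ is a wandering subspace for $T$ if $W\perp T^kW$ for all $k\in\mathbb N^n\setminus\{0\}$. $\bigvee$ denotes closed linear span, and $M\ominus\sum_iT_iM$ is the orthogonal complement of $\sum_iT_iM$ in $M$. *)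

(* Defs.v *)
From HB Require Import structures.
From mathcomp Require Import all_boot all_order all_algebra.
From mathcomp Require Import complex.
From mathcomp Require Import all_classical all_reals all_analysis.

Set Implicit Arguments.
Unset Strict Implicit.
Unset Printing Implicit Defensive.

Import Order.TTheory GRing.Theory Num.Theory.
Import numFieldNormedType.Exports.

Local Open Scope classical_set_scope.
Local Open Scope ring_scope.
Local Open Scope complex_scope.

Section HilbertSubspaces.
Context {R : realType} {H : completeNormedModType R[i]}.

(* The norm of H is the one induced by ip, so that H, which is complete, is a
   complex Hilbert space with inner product ip (linear in the first argument,
   conjugate-linear in the second one). *)
Definition induces_norm (ip : {dot H for @Num.conj R[i]}) : Prop :=
  forall x : H, `|x| ^+ 2 = ip x x.

Definition linear_subspace (M : set H) : Prop := submod_closed [in M].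

Definition closed_subspace (M : set H) : Prop := linear_subspace M /\ closed M.

Definition closed_span (A : set H) : set H :=
  closure (smallest linear_subspace A).

Definition orthogonal_sets (ip : {dot H for @Num.conj R[i]}) (A B : set H) :
    Prop :=
  forall x y : H, A x -> B y -> ip x y = 0.

Definition orthogonal_decomposition (ip : {dot H for @Num.conj R[i]})
    (Hk : nat -> set H) : Prop :=
  [/\ forall k, closed_subspace (Hk k),
      forall j k, j != k -> orthogonal_sets ip (Hk j) (Hk k) &
      closed_span (\bigcup_k Hk k) = setT].

Definition homogeneous (Hk : nat -> set H) (M : set H) : Prop :=
  closed_subspace M /\ M = closed_span (\bigcup_k (M `&` Hk k)).

End HilbertSubspaces.

Section Tuples.
Context {R : realType} {H : completeNormedModType R[i]} {n : nat}.
Implicit Types (T : 'I_n -> {linear H -> H}) (M W : set H).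

(* For linear maps, bounded_near at 0 is boundedness of the operator, see
   linear_boundedP and linear_bounded_continuous. *)
Definition commuting_bounded_tuple T : Prop :=
  (forall i, bounded_near (T i) (nbhs (0 : H))) /\
  (forall i j (x : H), T i (T j x) = T j (T i x)).

Definition of_degree (Hk : nat -> set H) (gamma : 'I_n -> nat) T : Prop :=
  forall k i, T i @` Hk k `<=` Hk (k + gamma i)%N.

Definition tuple_invariant T M : Prop := forall i, T i @` M `<=` M.

(* T^k = T_1^{k_1} ... T_n^{k_n} *)
Definition tuple_exp T (k : {ffun 'I_n -> nat}) : H -> H :=
  \big[comp/id]_(i < n) iter (k i) (T i).

Definition wandering (ip : {dot H for @Num.conj R[i]}) T W : Prop :=
  closed_subspace W /\
  forall k : {ffun 'I_n -> nat}, k != 0 ->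
    orthogonal_sets ip W (tuple_exp T k @` W).

Definition generated_subspace T W : set H :=
  closed_span (\bigcup_(k in [set: {ffun 'I_n -> nat}]) (tuple_exp T k @` W)).

(* The algebraic sum of the subspaces T_i M; it need not be closed. *)
Definition sum_images T M : set H :=
  [set \sum_(i < n) T i (x i) | x in [set x : 'I_n -> H | forall i, M (x i)]].

Definition wandering_part (ip : {dot H for @Num.conj R[i]}) T M : set H :=
  [set x | M x /\ forall y, sum_images T M y -> ip x y = 0].

End Tuples.

(* Main.v *)
(* A wandering subspace W is recovered from M = [W] without gradings: a vector
   of M orthogonal to W and to all T_i M is orthogonal to all T^k W, hence is
   0. Conversely, let M be homogeneous and invariant and N = [W_T(M)]. As the
   degrees gamma_i are positive, T_i raises the degree, so M `&` Hk k is
   contained in N by strong induction on k. *)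
Require Import Defs.
From HB Require Import structures.
From mathcomp Require Import all_boot all_order all_algebra.
From mathcomp Require Import complex.
From mathcomp Require Import all_classical all_reals all_analysis.
From mathcomp Require Import ring lra.

Set Implicit Arguments.
Unset Strict Implicit.
Unset Printing Implicit Defensive.

Import Order.TTheory GRing.Theory Num.Theory.
Import numFieldNormedType.Exports.

Local Open Scope classical_set_scope.
Local Open Scope ring_scope.
Local Open Scope complex_scope.

(** [4 * (2 * d + e) * e] is [4 * (d + e) ^+ 2 - (2 * d) ^+ 2], the bound that the parallelogram
    identity gives for two points at distance less than [d + e] from [x] whose midpoint is at
    distance at least [d]. *)
Lemma exists_small_quadratic (R : realFieldType) (d r : R) :
  0 <= d -> 0 < r -> exists2 e, 0 < e & 4 * (2 * d + e) * e < r.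
Proof.
move=> d0 r0; have d5 : 0 < 8 * d + 5 by lra.
(* As [e <= 1], the expression is at most [(8 * d + 4) * e], which is less than
   [(8 * d + 5) * e]. *)
have [] : let e := Num.min 1 (r / (8 * d + 5)) in
    [/\ 0 < e, e <= 1 & e * (8 * d + 5) <= r].
  rewrite /= lt_min ltr01 divr_gt0 //; split=> //.
    by rewrite ge_min lexx.
  by rewrite -ler_pdivlMr // ge_min lexx orbT.
move: (Num.min _ _) => e e0 e1 er; exists e => //.
have ee : e * e <= e by rewrite ger_pMr.
lra.
Qed.

(** * Closed subspaces and closed spans *)

Section Hilbert.
Context {R : realType} {H : completeNormedModType R[i]}.
Implicit Types (A M N V : set H) (x y z : H).

Lemma closed_subspace0 M : closed_subspace M -> M 0.
Proof. by case=> -[/set_mem]. Qed.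

Lemma closed_subspaceZD M a x y :
  closed_subspace M -> M x -> M y -> M (a *: x + y).
Proof.
by case=> -[_ +] _ Mx My => /(_ a x y); rewrite !inE; exact.
Qed.

Lemma closed_subspaceZ M a x : closed_subspace M -> M x -> M (a *: x).
Proof.
by move=> cM Mx; rewrite -[_ *: _]addr0; apply: closed_subspaceZD => //;
exact: closed_subspace0.
Qed.

Lemma closed_subspaceD M x y : closed_subspace M -> M x -> M y -> M (x + y).
Proof. by move=> cM Mx My; rewrite -[x]scale1r; exact: closed_subspaceZD. Qed.

Lemma closed_subspaceB M x y : closed_subspace M -> M x -> M y -> M (x - y).
Proof.
by move=> cM Mx My; rewrite addrC -scaleN1r; exact: closed_subspaceZD.
Qed.

Lemma closed_subspace_intro M : closed M -> M 0 ->
  (forall a x y, M x -> M y -> M (a *: x + y)) -> closed_subspace M.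
Proof.
by move=> cM M0 MZD; split=> //; split=> [|a x y]; rewrite !inE //; exact: MZD.
Qed.

Lemma closed_subspaceI M N :
  closed_subspace M -> closed_subspace N -> closed_subspace (M `&` N).
Proof.
move=> cM cN; apply: closed_subspace_intro; first exact: closedI cM.2 cN.2.
  by split; exact: closed_subspace0.
by move=> a x y [Mx Nx] [My Ny]; split; exact: closed_subspaceZD.
Qed.

Lemma closed_subspace_preimage (f : {linear H -> H}) N :
  continuous f -> closed_subspace N -> closed_subspace (f @^-1` N).
Proof.
move=> /continuous_closedP cf cN; apply: closed_subspace_intro.
- exact: cf cN.2.
- by rewrite /preimage /= linear0; exact: closed_subspace0.
- by move=> a x y Nx Ny; rewrite /preimage /= linearP; exact: closed_subspaceZD.
Qed.

Lemma linear_subspace_smallest A : linear_subspace (smallest linear_subspace A).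
Proof.
split=> [|a x y]; rewrite !inE; first by move=> B [[B0 _] _]; exact/set_mem.
move=> sx sy B sB.
by case: (sB) => -[_ /(_ a x y)]; rewrite !inE => + _; apply;
  [exact: sx|exact: sy].
Qed.

Lemma closed_span_closed_subspace A : closed_subspace (closed_span A).
Proof.
set S := smallest linear_subspace A.
have [S0 SZD] : linear_subspace S by exact: linear_subspace_smallest.
have cl B : closed B -> S `<=` B -> closed_span A `<=` B.
  by rewrite /closed_span closureE; exact: smallest_sub.
have clS : closed (closed_span A) by exact: closed_closure.
have Scl : S `<=` closed_span A by exact: subset_closure.
apply: closed_subspace_intro => //; first exact/Scl/set_mem.
(* Limits are taken in one variable at a time: first [y] is reduced to the algebraic span, then
   [x]. *)
move=> a x y Ax; apply: (cl (fun y => closed_span A (a *: x + y))).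
  apply: (continuous_closedP (fun y => a *: x + y)).1 clS.
  by move=> z; apply: cvgD; [exact: cvg_cst|exact: cvg_id].
move=> z Sz; apply: (cl (fun x => closed_span A (a *: x + z))) Ax => [|w Sw].
  apply: (continuous_closedP (fun x => a *: x + z)).1 clS.
  by move=> w; apply: cvgD; [apply: cvgZr; exact: cvg_id|exact: cvg_cst].
by have := SZD a w z; rewrite !inE => /(_ Sw Sz) /Scl.
Qed.

Lemma sub_closed_span A : A `<=` closed_span A.
Proof.
by apply: subset_trans (@subset_closure _ _); exact: sub_gen_smallest.
Qed.

Lemma closed_span_min A N :
  closed_subspace N -> A `<=` N -> closed_span A `<=` N.
Proof.
move=> [lN cN] AN; rewrite /closed_span closureE.
by apply: smallest_sub => //; exact: smallest_sub.
Qed.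

(** * Cauchy-Schwarz, orthogonal complements and orthogonal projection *)

Variable ip : {dot H for @Num.conj R[i]}.
Hypothesis ipE : induces_norm ip.

Lemma ip_eq0_sym x y : ip x y = 0 -> ip y x = 0.
Proof. by move=> xy; rewrite hermC /= xy rmorph0 mulr0. Qed.

(** Pythagoras for the projection of [x] to the line of [y]; it yields both Cauchy-Schwarz and the
    orthogonality at a closest point. *)
Lemma ip_sub_proj x y : y != 0 ->
  `|x - (ip x y / ip y y) *: y| ^+ 2 = `|x| ^+ 2 - `|ip x y| ^+ 2 / ip y y.
Proof.
rewrite -(dnorm_eq0 ip) => y0; rewrite !ipE dnormB dnormZ linearZr_LR /=.
have yr : Num.conj (ip y y) = ip y y by rewrite conj_Creal // ger0_real.
have -> : Num.conj (ip x y / ip y y) * ip x y = `|ip x y| ^+ 2 / ip y y.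
  by rewrite rmorphM /= fmorphV /= yr normCK; ring.
rewrite rmorphM /= fmorphV /= yr.
rewrite (conj_Creal (ger0_real (exprn_ge0 _ (normr_ge0 _)))).
rewrite normrM exprMn normfV (ger0_norm (dnorm_ge0 ip y)).
by field.
Qed.

Lemma normr_ip_le x y : `|ip x y| <= `|x| * `|y|.
Proof.
have [->|y0] := eqVneq y 0; first by rewrite linear0r !normr0 mulr0.
have yy : 0 < ip y y by rewrite dnorm_gt0.
rewrite -ler_sqr ?nnegrE ?mulr_ge0// exprMn (ipE y).
rewrite -ler_pdivrMr // -subr_ge0 -ip_sub_proj //.
Qed.

Lemma closed_subspace_orthogonal A :
  closed_subspace [set x | forall y, A y -> ip x y = 0].
Proof.
apply: closed_subspace_intro => [x clx y Ay|y _|a x y xA yA z Az]; last 2 first.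
- exact: linear0l.
- by rewrite linearDl /= linearZl_LR /= xA // yA // mulr0 addr0.
apply/eqP/negP => /negP xy0.
(* A point [z] of the complement within this radius of [x] would give
   [|ip x y| = |ip (x - z) y| < |ip x y|]. Adding 1 keeps the denominator positive. *)
have e0 : 0 < `|ip x y| / (`|y| + 1).
  by rewrite divr_gt0 ?normr_gt0 // ltr_wpDl.
have [z [zA]] := clx _ (nbhsx_ballx x _ e0).
rewrite -ball_normE /= => xz.
suff : `|ip x y| < `|ip x y| by rewrite ltxx.
have {1}-> : ip x y = ip (x - z) y by rewrite linearBl /= zA // subr0.
apply: le_lt_trans (normr_ip_le _ _) _.
apply: (@le_lt_trans _ _ (`|x - z| * (`|y| + 1))).
  by rewrite ler_wpM2l // lerDl.
by rewrite -ltr_pdivlMr // ltr_wpDl.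
Qed.

Lemma closed_subspace_orthogonal1 x : closed_subspace [set y | ip x y = 0].
Proof.
have := closed_subspace_orthogonal [set x].
congr closed_subspace; apply/seteqP; split=> y /=.
  by move=> /(_ x erefl); exact: ip_eq0_sym.
by move=> xy _ ->; exact: ip_eq0_sym.
Qed.

(** For [t = ip x y / ip y y], [ip_sub_proj] makes the right side strictly smaller unless [ip x y]
    vanishes. *)
Lemma orthogonal_of_closest x y :
  (forall t, `|x| <= `|x - t *: y|) -> ip x y = 0.
Proof.
have [->|y0] := eqVneq y 0; first by rewrite linear0r.
have yy : 0 < ip y y by rewrite dnorm_gt0.
move=> /(_ (ip x y / ip y y)).
rewrite -ler_sqr ?nnegrE // ip_sub_proj // lerBrDr gerDl ler_pdivrMr // mul0r.
move=> ip0; apply/eqP; rewrite -normr_eq0 -sqrf_eq0.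
by rewrite eq_le ip0 exprn_ge0.
Qed.

Lemma parallelogram x y :
  `|x - y| ^+ 2 = 2 * `|x| ^+ 2 + 2 * `|y| ^+ 2 - `|x + y| ^+ 2.
Proof. by rewrite !ipE dnormB dnormD; ring. Qed.

Lemma RRe_norm x : (complex.Re `|x|)%:C = `|x|.
Proof. by rewrite RRe_real ?normr_real. Qed.

Lemma Re_norm_ge0 x : 0 <= complex.Re `|x|.
Proof. by rewrite -ler0c RRe_norm. Qed.

(** [p] is a point of [M] closest to [x], obtained by completeness as a limit of near-minimizers of
    the distance. *)
Lemma orthogonal_projection M x : closed_subspace M ->
  exists2 p, M p & forall y, M y -> ip (x - p) y = 0.
Proof.
(* Norms lie in [R[i]]; real parts are taken to have an infimum in [R]. *)
move=> cM; pose dist m := complex.Re `|x - m|.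
have dist_ge0 m : 0 <= dist m by exact: Re_norm_ge0.
pose d := inf (dist @` M).
have d_le m : M m -> d <= dist m.
  by move=> Mm; apply: ge_inf; [exists 0 => _ [? _ <-]|exists m].
have d_ge0 : 0 <= d.
  by apply: lb_le_inf => [|_ [m _ <-]//]; exists (dist 0), 0 => //;
    exact: closed_subspace0.
have d_near e : 0 < e -> exists2 m, M m & dist m < d + e.
  move=> e0; have [|_ [m Mm <-] ?] := @inf_adherent _ (dist @` M) e e0.
    by split; [exists (dist 0), 0 => //; exact: closed_subspace0|
      exists 0 => _ [? _ <-]].
  by exists m.
(* The sets of near-minimizers of the distance generate a Cauchy filter. *)
pose B e := [set m | M m /\ dist m < d + e].
pose F := filter_from [set e : R | 0 < e] B.
have FF : Filter F.
  apply: filter_from_filter; first by exists 1 => /=.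
  move=> e f /= e0 f0; exists (Num.min e f) => /=; first by rewrite lt_min e0.
  by move=> m [Mm]; rewrite -ltrBlDl lt_min !ltrBlDl => /andP[].
have PF : ProperFilter F.
  by apply: filter_from_proper => e /= /d_near[m Mm ?]; exists m.
(* The midpoint of [m] and [m'] lies in [M], so [(x - m) + (x - m')] has norm at least [2 * d]; the
   parallelogram identity then bounds [m - m']. *)
have dist2 m m' e : M m -> M m' -> dist m < d + e -> dist m' < d + e ->
  complex.Re `|m - m'| ^+ 2 <= 4 * (2 * d + e) * e.
  move=> Mm Mm' dm dm'.
  have Mmid : M (2^-1 *: m + 2^-1 *: m').
    by apply: closed_subspaceD => //; exact: closed_subspaceZ.
  have /d_le := Mmid.
  have -> : dist (2^-1 *: m + 2^-1 *: m') =
      2^-1 * complex.Re `|(x - m) + (x - m')|.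
    apply: complexI; rewrite rmorphM /= !RRe_norm.
    have {1}-> : x = 2^-1 *: x + 2^-1 *: x.
      by rewrite -scalerDl -[2^-1]div1r -splitr scale1r.
    rewrite opprD addrACA -!scalerBr -scalerDr normrZ ger0_norm ?invr_ge0 //.
    rewrite fmorphV; congr (_^-1 * _); exact/esym/rmorph_nat.
  have : complex.Re `|m - m'| ^+ 2 =
      2 * dist m ^+ 2 + 2 * dist m' ^+ 2 - complex.Re `|(x - m) + (x - m')| ^+ 2.
    apply: complexI; rewrite !(rmorphB, rmorphD, rmorphM, rmorph1) /= !RRe_norm.
    transitivity (`|(x - m) - (x - m')| ^+ 2); last exact: parallelogram.
    by rewrite opprB [_ + (_ - x)]addrC addrA subrK distrC.
  move: dm dm' => /ltW dm /ltW dm' -> sd.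
  set s := complex.Re `|_ + _| in sd *.
  have : (2 * d) ^+ 2 <= s ^+ 2.
    by rewrite ler_sqr ?nnegrE ?Re_norm_ge0 ?mulr_ge0 //; lra.
  have : dist m ^+ 2 <= (d + e) ^+ 2 by rewrite ler_sqr ?nnegrE ?(le_trans _ dm).
  have : dist m' ^+ 2 <= (d + e) ^+ 2 by rewrite ler_sqr ?nnegrE ?(le_trans _ dm').
  move: (dist m ^+ 2) (dist m' ^+ 2) (s ^+ 2) => a b c; rewrite !expr2; lra.
have : cvg F.
  apply: cauchy_cvg; apply: cauchy_exP => eps eps0.
  pose r := complex.Re eps.
  have rE : eps = r%:C by rewrite RRe_real // gtr0_real.
  have r0 : 0 < r by rewrite -ltcR -rE; exact: eps0.
  have [e e0 er] := exists_small_quadratic d_ge0 (exprn_gt0 2 r0).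
  have [m0 Mm0 dm0] := d_near e e0.
  exists m0; exists e => // m [Mm dm].
  rewrite -ball_normE /= -RRe_norm rE ltcR -ltr_sqr ?nnegrE ?Re_norm_ge0 ?(ltW r0) //.
  exact: le_lt_trans (dist2 _ _ _ Mm0 Mm dm0 dm) er.
case/cvg_ex => p Fp.
have Mp : M p.
  apply: (@closed_cvg _ _ F PF id M cM.2 _ p Fp).
  by exists 1 => //= m [].
have dp : dist p <= d.
  apply/ler_addgt0Pr => e e0.
  have e20 : 0 < e / 2 by rewrite divr_gt0.
  have : F (ball p (e / 2)%:C) by apply: Fp; apply: nbhsx_ballx; rewrite ltcR.
  have : F (B (e / 2)) by exists (e / 2).
  move=> FB Fb; have [m [[_ dm]]] := @filter_ex _ _ PF _ (filterI FB Fb).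
  rewrite -ball_normE /= -RRe_norm ltcR => pm.
  have : dist p <= dist m + complex.Re `|p - m|.
    by rewrite -lecR rmorphD /= !RRe_norm (distrC p m) ler_distD.
  by move: dm pm; lra.
(* [x - p - t *: y] is the difference of [x] and the point [p + t *: y] of [M]. *)
exists p => // y My; apply: orthogonal_of_closest => t.
rewrite -(RRe_norm (x - p)) -(RRe_norm (x - p - _)) lecR; apply: le_trans dp _.
rewrite -addrA -opprD; apply: d_le; apply: closed_subspaceD => //.
exact: closed_subspaceZ.
Qed.
End Hilbert.

(** * Monomials in the tuple, generated subspaces and wandering parts, without grading *)

Section Tuples.
Context {R : realType} {H : completeNormedModType R[i]} {n : nat}.
Variables (ip : {dot H for @Num.conj R[i]}) (T : 'I_n -> {linear H -> H}).
Hypotheses (ipE : induces_norm ip) (cT : commuting_bounded_tuple T).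
Implicit Types (M N V W : set H) (k : {ffun 'I_n -> nat}).

Lemma tuple_exp_ind (P : (H -> H) -> Prop) :
  P id -> (forall f i, P f -> P (T i \o f)) -> forall k, P (tuple_exp T k).
Proof.
move=> Pid PT k; rewrite /tuple_exp.
elim/big_rec: _ => // i f _ Pf; elim: (k i) => [|m IH] /=; first exact: Pf.
exact: (PT (iter m (T i) \o f) i IH).
Qed.

Lemma tuple_exp0 : tuple_exp T 0 = id.
Proof. by rewrite /tuple_exp; elim/big_rec: _ => // i f _ ->; rewrite ffunE. Qed.

(** Commutativity moves the extra factor [T i] to the front. Relating [k] and [k'] by their values
    serves both to split off a factor and to add one. *)
Lemma tuple_expS k k' i x :
  k' i = (k i).+1 -> (forall j, j != i -> k' j = k j) ->
  tuple_exp T k' x = T i (tuple_exp T k x).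
Proof.
move=> k'i k'j; rewrite /tuple_exp.
have : i \in index_enum 'I_n by rewrite mem_index_enum.
have : uniq (index_enum 'I_n) by exact: index_enum_uniq.
(* The index [i] occurs exactly once in the list: before it, [T i] is commuted past the powers of
   [T j]; after it, the exponents agree. *)
elim: (index_enum 'I_n) => // j r IH /= /andP[jr ur].
rewrite !big_cons /= inE; have [eij _|ij /= ir] := eqVneq i j; last first.
  rewrite IH // k'j 1?eq_sym //.
  by elim: (k j) => //= m ->; rewrite cT.2.
subst j; rewrite k'i iterS; congr (T i (iter _ _ _)).
congr (_ x); apply: eq_big_seq => l lr; rewrite k'j //.
by apply: contraNneq jr => <-.
Qed.

Lemma tuple_exp_factor k : k != 0 ->
  exists i k', forall x, tuple_exp T k x = T i (tuple_exp T k' x).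
Proof.
move=> k0; have [i ki] : exists i, k i != 0.
  apply/existsP; apply: contraNT k0; rewrite negb_exists => /forallP k0.
  by apply/eqP/ffunP => i; rewrite ffunE; apply/eqP; rewrite -[_ == _]negbK.
exists i, [ffun j => if j == i then (k i).-1 else k j] => x.
apply: tuple_expS => [|j /negbTE ji]; rewrite ffunE ?eqxx ?ji //.
by rewrite prednK // lt0n.
Qed.

Lemma tuple_exp_next i k :
  exists2 k', k' != 0 & forall x, T i (tuple_exp T k x) = tuple_exp T k' x.
Proof.
exists [ffun j => if j == i then (k i).+1 else k j].
  by apply/eqP => /ffunP/(_ i); rewrite !ffunE eqxx.
move=> x; symmetry.
by apply: tuple_expS => [|j /negbTE ji]; rewrite ffunE ?eqxx ?ji.
Qed.

Lemma tuple_continuous i : continuous (T i).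
Proof. exact: (iffLR (linear_bounded_continuous (T i)) (cT.1 i)). Qed.

Lemma closed_subspace_preimage_tuple_exp k N :
  closed_subspace N -> closed_subspace (tuple_exp T k @^-1` N).
Proof.
move: k N; apply: (@tuple_exp_ind (fun f => forall N, closed_subspace N ->
  closed_subspace (f @^-1` N))) => // f i IH N cN.
by apply: (IH (T i @^-1` N)); apply: closed_subspace_preimage => //;
  exact: tuple_continuous.
Qed.

Lemma tuple_invariantP M :
  tuple_invariant T M <-> forall i x, M x -> M (T i x).
Proof.
by split=> [iM i x Mx|iM i _ [x Mx <-]]; [apply: (iM i); exists x|exact: iM].
Qed.

Lemma tuple_exp_invariant M k x :
  tuple_invariant T M -> M x -> M (tuple_exp T k x).
Proof.
move=> /tuple_invariantP iM; move: k x.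
apply: (@tuple_exp_ind (fun f => forall x, M x -> M (f x))) => // f i IH x /IH.
exact: iM.
Qed.

Lemma wandering_partP M x : closed_subspace M ->
  wandering_part ip T M x <->
  M x /\ forall i y, M y -> ip x (T i y) = 0.
Proof.
move=> cM; split=> -[Mx xM]; split=> //.
  (* [T i y] is the sum for the family that is [y] at [i] and 0 elsewhere. *)
  move=> i y My; apply: xM; exists (fun j => if j == i then y else 0).
    by move=> j; case: ifP => // _; exact: closed_subspace0.
  rewrite (bigD1 i) //= eqxx big1 ?addr0 // => j /negbTE ->.
  exact: linear0.
move=> _ [y My <-]; rewrite linear_sumr big1 // => i _; exact/xM/My.
Qed.

Lemma closed_subspace_wandering_part M :
  closed_subspace M -> closed_subspace (wandering_part ip T M).
Proof.
move=> cM; apply: closed_subspaceI => //.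
exact: closed_subspace_orthogonal.
Qed.

(** For nonzero [k], T^k factors as T_i T^k', and T^k' preserves [M]; so T^k maps the wandering part
    into T_i M. *)
Lemma wandering_wandering_part M :
  closed_subspace M -> tuple_invariant T M ->
  wandering ip T (wandering_part ip T M).
Proof.
move=> cM iM; split=> [|k /tuple_exp_factor[i [k' kE]] x _ Wx [y Wy <-]].
  exact: closed_subspace_wandering_part.
rewrite kE; apply: (iffLR (wandering_partP _ cM) Wx).2.
by apply: tuple_exp_invariant => //; case: Wy.
Qed.

Lemma closed_subspace_generated W : closed_subspace (generated_subspace T W).
Proof. exact: closed_span_closed_subspace. Qed.

Lemma generated_tuple_exp W k x : W x -> generated_subspace T W (tuple_exp T k x).
Proof. by move=> Wx; apply: sub_closed_span; exists k => //; exists x. Qed.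

Lemma sub_generated W : W `<=` generated_subspace T W.
Proof.
by move=> x /(@generated_tuple_exp _ 0); rewrite tuple_exp0.
Qed.

Lemma generated_min W N : closed_subspace N ->
  (forall k x, W x -> N (tuple_exp T k x)) -> generated_subspace T W `<=` N.
Proof.
by move=> cN WN; apply: closed_span_min => // _ [k _ [x Wx <-]]; exact: WN.
Qed.

Lemma tuple_invariant_generated W : tuple_invariant T (generated_subspace T W).
Proof.
apply/tuple_invariantP => i; apply: generated_min.
  apply: closed_subspace_preimage; first exact: tuple_continuous.
  exact: closed_subspace_generated.
move=> k x Wx; have [k' _ kE] := tuple_exp_next i k.
by rewrite /preimage /= kE; exact: generated_tuple_exp.
Qed.

Lemma wandering_part_generated W :
  wandering ip T W -> wandering_part ip T (generated_subspace T W) = W.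
Proof.
move=> [cW wW]; have cM := closed_subspace_generated W.
(* For [x] in [W], the [y] with [ip x (T i y) = 0] form a closed subspace; it contains every T^k W
   because T_i T^k has a nonzero exponent. *)
have sW : W `<=` wandering_part ip T (generated_subspace T W).
  move=> x Wx; apply/wandering_partP => //; split=> [|i]; first exact: (sub_generated Wx).
  apply: generated_min.
    apply: (@closed_subspace_preimage _ _ (T i) [set z | ip x z = 0]).
      exact: tuple_continuous.
    exact: closed_subspace_orthogonal1.
  move=> k y Wy; have [k' k'0 kE] := tuple_exp_next i k.
  by rewrite /preimage /= kE; apply: (wW _ k'0) => //; exists y.
rewrite eqEsubset; split=> // x /(wandering_partP _ cM)[Mx xT].
have [p Wp xp] := orthogonal_projection ipE x cW.
suff xp0 : x - p = 0 by move/eqP: xp0; rewrite subr_eq0 => /eqP ->.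
have /(wandering_partP _ cM)[Mp pT] := sW _ Wp.
have Mxp : generated_subspace T W (x - p) := closed_subspaceB cM Mx Mp.
apply/eqP; rewrite -(dnorm_eq0 ip); apply/eqP.
have {}xT i y : generated_subspace T W y -> ip (x - p) (T i y) = 0.
  by move=> My; rewrite linearBl /= xT // pT // subr0.
move: (x - p) xT Mxp xp => z zT Mz zW.
(* As [z] itself is in the generated subspace, this makes [z] orthogonal to itself. *)
suff : generated_subspace T W `<=` [set y | ip z y = 0] by exact.
apply: generated_min => [|k y Wy]; first exact: closed_subspace_orthogonal1.
have [->|/tuple_exp_factor[i [k' kE]]] := eqVneq k 0.
  by rewrite tuple_exp0; exact: zW.
by rewrite /= kE; apply: zT; exact: generated_tuple_exp.
Qed.

End Tuples.

(** * Homogeneous subspaces and operators of positive degree *)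

Section Graded.
Context {R : realType} {H : completeNormedModType R[i]} {n : nat}.
Variables (ip : {dot H for @Num.conj R[i]}) (Hk : nat -> set H).
Hypotheses (ipE : induces_norm ip) (oHk : orthogonal_decomposition ip Hk).
Implicit Types (M V W : set H).

Lemma homogeneous_span M N : homogeneous Hk M -> closed_subspace N ->
  (forall k x, M x -> Hk k x -> N x) -> M `<=` N.
Proof.
move=> [_ ME] cN MN; rewrite ME; apply: closed_span_min => // x [k _ []].
exact: MN.
Qed.

Lemma homogeneousI M : closed_subspace M ->
  M `<=` closed_span (\bigcup_k (M `&` Hk k)) -> homogeneous Hk M.
Proof.
move=> cM sM; split=> //; rewrite eqEsubset; split=> //.
by apply: closed_span_min => // x [k _ []].
Qed.

(* The hypothesis on V says that V contains the orthogonal projections of its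
   elements to the spaces M `&` Hk k. *)
Lemma homogeneous_sub M V : homogeneous Hk M -> closed_subspace V -> V `<=` M ->
  (forall k x p, V x -> M p -> Hk k p ->
     (forall y, M y -> Hk k y -> ip (x - p) y = 0) -> V p) ->
  homogeneous Hk V.
Proof.
move=> hM cV VM compV; apply: homogeneousI => // x Vx.
set N := closed_span _.
have cN : closed_subspace N by exact: closed_span_closed_subspace.
have NV : N `<=` V by apply: closed_span_min => // y [k _ []].
(* The residue [x - q] is in [V] and orthogonal to [N]; it is shown orthogonal to every [M]&[Hk k],
   hence to [M], which contains it. *)
have [q Nq zN] := orthogonal_projection ipE x cN.
suff : x - q = 0 by move/eqP; rewrite subr_eq0 => /eqP ->.
have Vz : V (x - q) := closed_subspaceB cV Vx (NV _ Nq).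
move: (x - q) Vz zN => z Vz zN.
apply/eqP; rewrite -(dnorm_eq0 ip); apply/eqP.
suff : M `<=` [set y | ip z y = 0] by apply; exact: VM.
apply: homogeneous_span => // [|k y My Hy]; first exact: closed_subspace_orthogonal1.
have [cH _ _] := oHk.
have [p [Mp Hp] zp] :=
  orthogonal_projection ipE z (closed_subspaceI hM.1 (cH k)).
have Np : N p.
  apply: sub_closed_span; exists k => //; split=> //.
  by apply: (compV k z) => // w Mw Hw; exact: zp.
(* [p] is orthogonal to [z], being in [N], and to [z - p], being in [M]&[Hk k]; so it is orthogonal
   to itself. *)
suff p0 : p = 0 by have := zp y (conj My Hy); rewrite p0 subr0.
apply/eqP; rewrite -(dnorm_eq0 ip); apply/eqP.
by have /eqP := zp p (conj Mp Hp); rewrite linearBl /= zN // sub0r oppr_eq0 => /eqP.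
Qed.

Variables (gamma : 'I_n -> nat) (T : 'I_n -> {linear H -> H}).
Hypotheses (gamma_gt0 : forall i, (0 < gamma i)%N).
Hypotheses (cT : commuting_bounded_tuple T) (dT : of_degree Hk gamma T).

Lemma of_degreeP k i x : Hk k x -> Hk (k + gamma i)%N (T i x).
Proof. by move=> Hx; apply: dT; exists x. Qed.

Lemma tuple_exp_degree k j : exists j', forall x, Hk j x -> Hk j' (tuple_exp T k x).
Proof.
move: k j; apply: (@tuple_exp_ind _ _ _ _ (fun f => forall j, exists j',
  forall x, Hk j x -> Hk j' (f x))) => [j|f i IH j]; first by exists j.
by have [j' fj'] := IH j; exists (j' + gamma i)%N => x /fj' /of_degreeP; exact.
Qed.

(** Let [p] be the projection of [x] to [M]&[Hk k]. For homogeneous [y] in [M], either [T i y] has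
    degree [k] and pairs with [p] as with [x], or it has another degree and is orthogonal to [p]. *)
Lemma homogeneous_wandering_part M : homogeneous Hk M -> tuple_invariant T M ->
  homogeneous Hk (wandering_part ip T M).
Proof.
move=> hM /tuple_invariantP iM; have cM := hM.1.
apply: (homogeneous_sub hM); first exact: closed_subspace_wandering_part.
  by move=> x [].
move=> k x p /(wandering_partP _ _ _ cM)[Mx xT] Mp Hp xp; apply/wandering_partP => //.
split=> // i.
apply: (homogeneous_span hM) => [|j y My Hy].
  apply: (@closed_subspace_preimage _ _ (T i) [set z | ip p z = 0]).
    exact: tuple_continuous.
  exact: closed_subspace_orthogonal1.
have MTy := iM i _ My; have HTy := of_degreeP i Hy.
rewrite /preimage /=; have [jk|jk] := eqVneq k (j + gamma i)%N.
  have := xp _ MTy; rewrite jk => /(_ HTy) /eqP.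
  by rewrite linearBl /= xT // sub0r oppr_eq0 => /eqP.
by have [_ oH _] := oHk; exact: oH jk _ _ Hp HTy.
Qed.

(** Monomials send homogeneous vectors of [W] to homogeneous vectors, and by linearity and
    continuity these images determine the closed span. *)
Lemma homogeneous_generated W :
  homogeneous Hk W -> homogeneous Hk (generated_subspace T W).
Proof.
move=> hW; apply: homogeneousI; first exact: closed_subspace_generated.
set N := closed_span (\bigcup_k _).
have cN : closed_subspace N by exact: closed_span_closed_subspace.
apply: generated_min => // k x; move: x.
apply: (homogeneous_span hW); first exact: closed_subspace_preimage_tuple_exp.
move=> j x Wx Hx; have [j' kj'] := tuple_exp_degree k j.
apply: sub_closed_span; exists j' => //.
by split; [exact: generated_tuple_exp|exact: kj'].
Qed.

(* A vector of M `&` Hk k orthogonal to N `&` Hk k, where N is the generated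
   subspace, is orthogonal to N; it is then orthogonal to each
   T i (M `&` Hk j), which is not orthogonal to Hk k only if j < k and is then
   contained in N by induction. So it lies in the wandering part of M. *)
Lemma generated_wandering_part M : homogeneous Hk M -> tuple_invariant T M ->
  generated_subspace T (wandering_part ip T M) = M.
Proof.
move=> hM iM; have cM := hM.1; set N := generated_subspace _ _.
have hN : homogeneous Hk N by apply/homogeneous_generated/homogeneous_wandering_part.
have NM : N `<=` M.
  by apply: generated_min => // k x [Mx _]; exact: tuple_exp_invariant.
rewrite eqEsubset; split=> //; apply: (homogeneous_span hM); first exact: hN.1.
move=> k; have [m] := ubnP k; elim: m k => // m IH k; rewrite ltnS => km x Mx Hx.
have [cH oH _] := oHk.
have [p [Np Hp] xp] :=
  orthogonal_projection ipE x (closed_subspaceI hN.1 (cH k)).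
suff xp0 : x - p = 0 by move/eqP: xp0; rewrite subr_eq0 => /eqP ->.
have Mz : M (x - p) := closed_subspaceB cM Mx (NM _ Np).
have Hz : Hk k (x - p) := closed_subspaceB (cH k) Hx Hp.
move: (x - p) Mz Hz xp => {x p Mx Hx Np Hp} z Mz Hz zNk.
have zN y : N y -> ip z y = 0.
  move: y; apply: (homogeneous_span hN) => [|j y Ny Hy].
    exact: closed_subspace_orthogonal1.
  have [jk|jk] := eqVneq k j; last exact: oH jk _ _ Hz Hy.
  by apply: zNk; rewrite jk.
(* A [z] in the wandering part would lie in [N], to which it is orthogonal. *)
suff /sub_generated Nz : wandering_part ip T M z.
  by apply/eqP; rewrite -(dnorm_eq0 ip); apply/eqP/zN/Nz.
apply/wandering_partP => //; split=> // i.
apply: (homogeneous_span hM) => [|j y My Hy].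
  apply: (@closed_subspace_preimage _ _ (T i) [set y | ip z y = 0]).
    exact: tuple_continuous.
  exact: closed_subspace_orthogonal1.
rewrite /preimage /=; have HTy := of_degreeP i Hy.
have [kj|kj] := eqVneq k (j + gamma i)%N; last exact: oH kj _ _ Hz HTy.
have /tuple_invariantP iN := @tuple_invariant_generated _ _ _ _ cT (wandering_part ip T M).
(* Positivity of [gamma i] gives [j < k], so [y] is in [N] by induction and [T i y] by
   invariance. *)
by apply/zN/iN/(IH j) => //; rewrite (leq_trans _ km) // kj -addn1 leq_add2l.
Qed.

End Graded.

(** * The bijection and its inverse *)

Theorem corollary2p2 (R : realType) (H : completeNormedModType R[i])
    (ip : {dot H for @Num.conj R[i]}) (Hk : nat -> set H) (n : nat)
    (gamma : 'I_n -> nat) (T : 'I_n -> {linear H -> H}) :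
  induces_norm ip ->
  orthogonal_decomposition ip Hk ->
  (forall i, (0 < gamma i)%N) ->
  commuting_bounded_tuple T ->
  of_degree Hk gamma T ->
  let HW := [set W : set H | homogeneous Hk W /\ wandering ip T W] in
  let HI := [set M : set H | homogeneous Hk M /\ tuple_invariant T M] in
  [/\ set_bij HW HI (generated_subspace T),
      set_fun HI HW (wandering_part ip T),
      {in HW, cancel (generated_subspace T) (wandering_part ip T)} &
      {in HI, cancel (wandering_part ip T) (generated_subspace T)}].
Proof.
move=> ipE oHk gamma_gt0 cT dT HW HI.
have genK W : HW W -> wandering_part ip T (generated_subspace T W) = W.
  by case=> _; exact: wandering_part_generated.
have partK M : HI M -> generated_subspace T (wandering_part ip T M) = M.
  by case; exact: generated_wandering_part.
have gen_fun : set_fun HW HI (generated_subspace T).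
  move=> W [hW _]; split; first exact: homogeneous_generated dT _ hW.
  exact: tuple_invariant_generated.
have part_fun : set_fun HI HW (wandering_part ip T).
  move=> M [hM iM]; split; first exact: homogeneous_wandering_part dT _ hM iM.
  by apply: wandering_wandering_part => //; exact: hM.1.
split=> //; last 2 first.
- by move=> W /set_mem; exact: genK.
- by move=> M /set_mem; exact: partK.
(* Injectivity comes from recovering [W] as a wandering part, surjectivity from generating [M] by
   its wandering part. *)
split=> // [W W' /set_mem/genK {2}<- /set_mem/genK {2}<- ->//|M HIM].
by exists (wandering_part ip T M); [exact: part_fun|exact: partK].
Qed.
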